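(* Let $\Omega\subset\mathbb{R}^n$, $n\ge2$, be a bounded domain, and let $f:\overline\Omega\to(0,\infty)$ and $g:\partial\Omega\times[0,\infty)\to(0,\infty)$ be continuous. Suppose that $\phi\in C(\Omega_\infty\cup P_\infty)$, $\phi>0$, satisfies, in the viscosity sense, $$\Delta_\infty\phi\ge3\phi^2\phi_t\ \text{ in }\Omega_\infty,$$ together with $\phi(x,0)=f(x)$ for all $x\in\overline\Omega$ and $\phi(x,t)=g(x,t)$ for all $(x,t)\in\partial\Omega\times[0,\infty)$. If $\lim_{t\to\infty}\left(\sup_{x\in\partial\Omega}g(x,t)\right)=0$, then $$\lim_{t\to\infty}\Big(\sup_{\Omega\times[t,\infty)}\phi\Big)=0 .$$
   Context: Notation: $\Omega_\infty=\Omega\times(0,\infty)$ and $P_\infty=(\Omega\times\{0\})\cup(\partial\Omega\times[0,\infty))$, so $\Omega_\infty\cup P_\infty=\overline\Omega\times[0,\infty)$. $\Delta_\infty\phi=\sum_{i,j}\phi_{x_i}\phi_{x_j}\phi_{x_ix_j}$. $\mathcal S(n)$ is the set of symmetric $n\times n$ real matrices. For $(y,s)\in\Omega_\infty$, $(a,p,X)\in\mathbb{R}\times\mathbb{R}^n\times\mathcal S(n)$ belongs to $\mathcal P^+_{\Omega_\infty}\phi(y,s)$ if $\phi(x,t)\le\phi(y,s)+a(t-s)+\langle p,x-y\rangle+\tfrac12\langle X(x-y),x-y\rangle+o(|t-s|+|x-y|^2)$ as $(x,t)\to(y,s)$ in $\Omega_\infty$. $\Delta_\infty\phi\ge3\phi^2\phi_t$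 in $\Omega_\infty$ means: $\phi$ is upper semi-continuous in $\Omega_\infty$ and $\langle Xp,p\rangle-3a\,\phi(y,s)^2\ge0$ for all $(y,s)\in\Omega_\infty$ and $(a,p,X)\in\mathcal P^+_{\Omega_\infty}\phi(y,s)$. *)

(* Defs.v *)
From HB Require Import structures.
From mathcomp Require Import all_boot all_order all_algebra.
From mathcomp Require Import all_classical all_reals all_analysis.

Set Implicit Arguments.
Unset Strict Implicit.
Unset Printing Implicit Defensive.

Import Order.TTheory GRing.Theory Num.Theory.
Import numFieldNormedType.Exports.

Local Open Scope classical_set_scope.
Local Open Scope ring_scope.

Section defs.
Context {R : realType} {n : nat}.
Implicit Types (u v p : 'rV[R]_n) (X : 'M[R]_n) (Omega : set 'rV[R]_n).

Definition dotv u v : R := \sum_(i < n) u ord0 i * v ord0 i.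

(* The library norm on 'rV[R]_n is the sup norm, hence this one. *)
Definition enorm u : R := Num.sqrt (dotv u u).

Definition bounded_domain Omega : Prop :=
  [/\ open Omega, connected Omega, Omega !=set0 & bounded_set Omega].

Definition boundary Omega : set 'rV[R]_n := closure Omega `\` interior Omega.

(* Points of space-time are pairs (x, t). *)
Definition cylinder Omega : set ('rV[R]_n * R) := Omega `*` `]0, +oo[.

Definition parabolic_boundary Omega : set ('rV[R]_n * R) :=
  (Omega `*` [set 0]) `|` (boundary Omega `*` `[0, +oo[).

Definition usc_in (D : set ('rV[R]_n * R)) (phi : 'rV[R]_n * R -> R) : Prop :=
  forall z, D z -> forall c, phi z < c ->
    \forall w \near within D (nbhs z), phi w < c.

(* The product p *m X stands for X p: the two agree because X is symmetric. *)
Definition parabolic_superjet (D : set ('rV[R]_n * R))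
    (phi : 'rV[R]_n * R -> R) (y : 'rV[R]_n) (s : R)
    : set (R * 'rV[R]_n * 'M[R]_n) :=
  [set j | let: (a, p, X) := j in
    X^T = X /\
    exists2 r : 'rV[R]_n * R -> R,
      r =o_ (within D (nbhs (y, s)))
        (fun z => `|z.2 - s| + enorm (z.1 - y) ^+ 2) &
      \forall z \near within D (nbhs (y, s)),
        phi z <= phi (y, s) + a * (z.2 - s) + dotv p (z.1 - y)
                 + 2^-1 * dotv ((z.1 - y) *m X) (z.1 - y) + r z].

(* Delta_oo phi >= 3 phi^2 phi_t in D, in the viscosity sense. *)
Definition viscosity_subsolution (D : set ('rV[R]_n * R))
    (phi : 'rV[R]_n * R -> R) : Prop :=
  usc_in D phi /\
  forall y s, D (y, s) -> forall a p X, parabolic_superjet D phi y s (a, p, X) ->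
    0 <= dotv (p *m X) p - 3 * a * phi (y, s) ^+ 2.

End defs.

(* Main.v *)
Require Import Defs.
From mathcomp Require Import all_boot all_order all_algebra.
From mathcomp Require Import all_classical all_reals all_analysis.
From mathcomp Require Import ring lra.
Import Order.TTheory GRing.Theory Num.Theory.
Import numFieldNormedType.Exports.
Local Open Scope classical_set_scope.
Local Open Scope ring_scope.

(** The idea is to compare phi with a separated barrier w(x, t) = h(x) / L(t),
    where h is a concave parabola in one coordinate of x, strictly monotone on
    the closure of Omega. The equation is homogeneous of degree three under
    phi |-> k phi, so every multiple k w is a strict supersolution as soon as
    w is. Substituting, Delta_oo w < 3 w^2 w_t amounts to
    3 h^3 L' < 8 (x_i - b)^2 L: the concavity of h beats the time derivative
    provided L grows slowly compared with itself.

    Homogeneity makes the comparison multiplicative (barrier_comparison): let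
    k be the maximum of phi L / h over the closure of Omega times [T, T'].
    Were it attained at an interior point, k w would touch phi from above
    there, and its derivatives would form an element of the superjet of phi
    (parabolic_superjet_product) that violates the subsolution inequality. If
    L vanishes at T', the maximum is not attained at the final time either, so
    it is controlled by the values of phi at time T and on the lateral
    boundary.

    For the decay (subsolution_uniform_decay), let phi <= eps on the lateral
    boundary from time T on, and phi <= M at time T. With v = t - T, take
    L = (tau0 + v) (S - v): it satisfies L' < L / tau0 where positive, whence
    the differential inequality for tau0 large, depending on Omega alone. Its
    maximum is attained at v = tau = (S - tau0) / 2 and equals
    (tau + tau0)^2, so the lateral data contribute at most
    eps (tau + tau0)^2 to phi L, whereas the initial data contribute
    M tau0 S, which is only linear in tau. Hence for tau large the lateral
    bound wins, and evaluating the comparison at the peak of L gives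
    phi <= eps h at time T + tau. Since S is free, every late time is the peak
    of such an L. *)

(** * Superjets of separated barriers *)

Lemma dotv_scale_delta (R : realType) (n : nat) (i : 'I_n) (a : R)
    (v : 'rV[R]_n) :
  dotv (a *: delta_mx ord0 i) v = a * v ord0 i.
Proof.
rewrite /dotv (bigD1 i) //= big1 ?addr0.
  by rewrite !mxE !eqxx mulr1.
by move=> j ji; rewrite !mxE (negbTE ji) andbF mulr0 mul0r.
Qed.

Lemma mulmx_scale_delta (R : realType) (n : nat) (i : 'I_n) (a : R)
    (v : 'rV[R]_n) :
  v *m (a *: delta_mx i i) = (a * v ord0 i) *: delta_mx ord0 i.
Proof.
apply/rowP => j; rewrite !mxE (bigD1 i) //= big1 ?addr0.
  by rewrite !mxE !eqxx /=; case: eqVneq => _ /=; ring.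
by move=> k ki; rewrite !mxE (negbTE ki) /= !mulr0.
Qed.

Lemma is_derive_first_order (R : realType) (Th : R -> R) (s dTh e : R) :
  is_derive s 1 Th dTh -> 0 < e ->
  \forall t \near s, `|Th t - Th s - dTh * (t - s)| <= e * `|t - s|.
Proof.
move=> dT e0.
have /derivable_nbhs/eqaddoP/(_ e e0) := @ex_derive _ _ _ _ _ _ _ dT.
rewrite /= !near_simpl => H; rewrite (near_shift 0) subr0.
move: H; apply: filter_app; near=> t.
have -> : 'D_1 Th s = dTh by exact: derive_val.
rewrite /= !fctE /= /GRing.scale /= mulr1 addrK.
by rewrite opprD addrA [dTh * _]mulrC.
Unshelve. all: by end_near. Qed.

Definition parabola {R : realType} {n : nat} (i : 'I_n) (c b : R)
    (x : 'rV[R]_n) : R :=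
  c - (x ord0 i - b) ^+ 2.

Lemma parabola_continuous (R : realType) (n : nat) (i : 'I_n) (c b : R) :
  continuous (parabola i c b).
Proof.
have qcont : continuous (fun u : R => c - (u - b) ^+ 2).
  move=> u; apply: (@continuousB _ _ _ (cst c) (fun v => (v - b) ^+ 2)).
    exact: cst_continuous.
  apply: (@continuous_comp _ _ _ (fun v : R => v - b) (fun v => v ^+ 2)).
    apply: (@continuousB _ _ _ id (cst b)); first exact: cvg_id.
    exact: cst_continuous.
  exact: exprn_continuous.
move=> x.
apply: (@continuous_comp _ _ _ (fun x : 'rV[R]_n => x ord0 i)
  (fun u => c - (u - b) ^+ 2)).
  exact: coord_continuous.
exact: qcont.
Qed.

(** The differential data of x, t |-> h x * Th t at a touching point. As h is
    exactly quadratic, the only errors in the expansion are the cross term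
    (h z - h y) Th' (t - s) and h z times the first-order error of Th; both
    are o(|t - s|). *)
Lemma parabolic_superjet_product (R : realType) (n : nat)
    (D : set ('rV[R]_n * R)) (phi : 'rV[R]_n * R -> R) (y : 'rV[R]_n) (s : R)
    (i : 'I_n) (c b : R) (Th : R -> R) (dTh : R) :
  let h := parabola i c b in
  is_derive s 1 Th dTh ->
  phi (y, s) = h y * Th s ->
  (\forall z \near within D (nbhs (y, s)), phi z <= h z.1 * Th z.2) ->
  parabolic_superjet D phi y s
    (h y * dTh, (- 2 * Th s * (y ord0 i - b)) *: delta_mx ord0 i,
     (- 2 * Th s) *: delta_mx i i).
Proof.
move=> h dT phiE phile; split; first by rewrite linearZ /= trmx_delta.
exists (fun z => (h z.1 - h y) * dTh * (z.2 - s)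
          + h z.1 * (Th z.2 - Th s - dTh * (z.2 - s))); last first.
  move: phile; apply: filterS => z /le_trans; apply.
  rewrite mulmx_scale_delta !dotv_scale_delta phiE.
  rewrite ![(z.1 - y) _ _]mxE ![(- y) _ _]mxE /h /parabola.
  lra.
have hcont : {for y, continuous h} by exact: parabola_continuous.
rewrite eqoP => e e0.
set C := `|h y| + 1.
have C0 : 0 < C by rewrite /C; have := normr_ge0 (h y); lra.
set E := `|dTh| + 1.
have E0 : 0 < E by rewrite /E; have := normr_ge0 dTh; lra.
apply: cvg_within.
(* C bounds h near y, and E bounds dTh while staying nonzero. *)
have H1 : \forall z \near (y, s), `|h y - h z.1| <= e / 2 / E.
  have Q : \forall x \near y, `|h y - h x| <= e / 2 / E.
    by move/cvgrPdist_le : hcont; apply; rewrite !divr_gt0.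
  exact: cvg_fst Q.
have H2 : \forall z \near (y, s), `|h y - h z.1| <= 1.
  have Q : \forall x \near y, `|h y - h x| <= 1.
    by move/cvgrPdist_le : hcont; apply.
  exact: cvg_fst Q.
have H3 : \forall z \near (y, s),
    `|Th z.2 - Th s - dTh * (z.2 - s)| <= e / 2 / C * `|z.2 - s|.
  have Q : 0 < e / 2 / C by rewrite !divr_gt0.
  exact: cvg_snd (@is_derive_first_order _ _ _ _ _ dT Q).
near=> z.
have h1 : `|h y - h z.1| <= e / 2 / E by near: z.
have h2 : `|h y - h z.1| <= 1 by near: z.
have h3 : `|Th z.2 - Th s - dTh * (z.2 - s)| <= e / 2 / C * `|z.2 - s|.
  by near: z.
have hz : `|h z.1| <= C.
  rewrite /C -[h z.1](subrK (h y)) addrC (le_trans (ler_normD _ _)) //.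
  by rewrite lerD2l distrC.
have A1 : `|(h z.1 - h y) * dTh * (z.2 - s)| <= e / 2 * `|z.2 - s|.
  rewrite !normrM ler_wpM2r// distrC.
  apply: (@le_trans _ _ (e / 2 / E * E)).
    by rewrite ler_pM// /E lerDl.
  by rewrite divfK// gt_eqF.
have A2 : `|h z.1 * (Th z.2 - Th s - dTh * (z.2 - s))| <= e / 2 * `|z.2 - s|.
  rewrite normrM.
  apply: (@le_trans _ _ (C * (e / 2 / C * `|z.2 - s|))).
    by rewrite ler_pM.
  by rewrite mulrA [C * _]mulrC divfK// gt_eqF.
apply: (le_trans (ler_normD _ _)).
apply: (le_trans (lerD A1 A2)).
rewrite -mulrDl -splitr ler_wpM2l ?(ltW e0)//.
rewrite [leRHS]ger0_norm ?addr_ge0 ?exprn_even_ge0//.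
by rewrite lerDl exprn_even_ge0.
Unshelve. all: by end_near. Qed.

(** * Comparison with a barrier *)

Lemma is_derive_scale_inv (R : realType) (L : R -> R) (k s dL : R) :
  L s != 0 -> is_derive s 1 L dL ->
  is_derive s 1 (fun t => k * (L t)^-1) (k * (- (L s) ^- 2 * dL)).
Proof. by move=> Ls dLP; have dV := is_deriveV Ls dLP; apply: is_deriveZ. Qed.

(** A maximum principle for the quotient of phi by the barrier h / L. Working
    with phi L / h rather than phi - h / L uses the homogeneity of the
    equation, and it tames the final time: there the quotient is continuous
    and nonpositive, whereas the barrier itself may blow up. *)
Lemma barrier_comparison (R : realType) (n : nat) (Omega : set 'rV[R]_n)
    (phi : 'rV[R]_n * R -> R) (i : 'I_n) (c b T T' K : R) (L dL : R -> R) :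
  let h := parabola i c b in
  open Omega -> compact (closure Omega) -> 0 <= T ->
  {within closure Omega `*` `[T, T'], continuous phi} ->
  (forall z : 'rV[R]_n * R, (closure Omega `*` `[T, T']) z -> 0 < phi z) ->
  viscosity_subsolution (cylinder Omega) phi ->
  (forall x : 'rV[R]_n, closure Omega x -> 0 < h x) ->
  (forall t : R, is_derive t 1 L (dL t)) ->
  (forall x t, Omega x -> T < t < T' -> 0 < L t ->
     3 * h x ^+ 3 * dL t < 8 * (x ord0 i - b) ^+ 2 * L t) ->
  0 < K ->
  (forall x : 'rV[R]_n, closure Omega x -> phi (x, T) * L T <= K * h x) ->
  (forall x t, boundary Omega x -> T <= t <= T' ->
     phi (x, t) * L t <= K * h x) ->
  L T' <= 0 ->
  forall (x : 'rV[R]_n) (t : R), closure Omega x -> T <= t <= T' ->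
    phi (x, t) * L t <= K * h x.
Proof.
move=> h oO cO T0 phic phi0 [_ sub] h0 dLP Lsup K0 hbot hlat Ltop x t Ox tT.
pose A := closure Omega `*` `[T, T'].
pose q z := phi z * L z.2 * (h z.1)^-1.
have Lc : continuous L.
  by move=> u; apply/differentiable_continuous/derivable1_diffP.
have hc1 : {within A, continuous (fun z => h z.1)}.
  apply: continuous_subspaceT => w.
  by apply: (@continuous_comp _ _ _ fst h);
    [exact: cvg_fst|exact: parabola_continuous].
have Lc2 : {within A, continuous (fun z => L z.2)}.
  apply: continuous_subspaceT => w.
  by apply: (@continuous_comp _ _ _ snd L); [exact: cvg_snd|exact: Lc].
have qc : {within A, continuous q}.
  rewrite continuous_subspace_in => z; rewrite inE => Az.
  apply: (@continuousM _ (subspace A) (fun z => phi z * L z.2)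
    (fun z => (h z.1)^-1)).
    by apply: (@continuousM _ (subspace A) phi (fun z => L z.2));
      [exact: phic|exact: Lc2].
  apply: (@continuousV _ (subspace A) (fun z => h z.1)); last exact: hc1.
  by rewrite gt_eqF// h0//; case: Az.
have Axt : A (x, t) by split => //=; rewrite in_itv.
have [[/= y s']] := compact_EVT_max (ex_intro _ _ Axt)
  (compact_setX cO (@segment_compact _ T T')) qc.
rewrite inE; pose s : R := s'; rewrite -[s']/s => Ays qmax.
have [/= Oy] := Ays; rewrite in_itv /= => /andP[Ts sT].
rewrite -ler_pdivrMr ?h0// -/(q (x, t)).
rewrite (le_trans (qmax _ _)) ?inE//.
set k := q (y, s); rewrite leNgt; apply/negP => kK.
have hy := h0 _ Oy.
have kE : phi (y, s) * L s = k * h y by rewrite /k /q /= divfK// gt_eqF.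
have big : K * h y < phi (y, s) * L s by rewrite kE ltr_pM2r.
have k0 : 0 < k := lt_trans K0 kK.
have phiys := phi0 _ Ays.
have Ls : 0 < L s by rewrite -(pmulr_rgt0 _ phiys) kE mulr_gt0.
have {}Ts : T < s.
  rewrite lt_neqAle Ts andbT; apply/eqP => TE.
  by move: big; rewrite -TE ltNge hbot.
have {}sT : s < T'.
  rewrite lt_neqAle sT andbT; apply/eqP => sE.
  by move: Ls; rewrite sE ltNge Ltop.
have Oy' : Omega y.
  apply: contrapT => nO.
  have By : boundary Omega y by rewrite /boundary (proj1 (interior_id _) oO).
  by move: big; rewrite ltNge hlat// !ltW.
(* From here on (y, s) is interior, and k h / L touches phi from above there. *)
have s0 : 0 < s := le_lt_trans T0 Ts.
pose Th := fun t => k * (L t)^-1.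
have dTh : is_derive (s : R) 1 Th (k * (- (L s) ^- 2 * dL s)).
  by apply: is_derive_scale_inv => //; rewrite gt_eqF.
have phiE : phi (y, s) = h y * Th s.
  by rewrite /Th mulrA [h y * k]mulrC -kE mulfK// gt_eqF.
have phile : \forall z \near within (cylinder Omega) (nbhs (y, s)),
    phi z <= h z.1 * Th z.2.
  apply: cvg_within.
  have nO : \forall z \near (y, s), Omega z.1.
    have Q : \forall x \near y, Omega x by exact: open_nbhs_nbhs.
    exact: cvg_fst Q.
  have nt : \forall z \near (y, s), T < z.2 < T'.
    have Q : \forall u \near s, T < u < T'.
      have sI : s \in `]T, T'[ by rewrite in_itv /= Ts.
      by move: (near_in_itvoo sI); apply: filterS => u; rewrite in_itv.
    exact: cvg_snd Q.
  have nL : \forall z \near (y, s), 0 < L z.2.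
    have Q : \forall u \near s, 0 < L u by exact: (cvgr_gt (L s)) (Lc s) _ Ls.
    exact: cvg_snd Q.
  near=> z.
  have Oz : Omega z.1 by near: z.
  have tz : T < z.2 < T' by near: z.
  have Lz : 0 < L z.2 by near: z.
  have Az : A z.
    split; first exact: subset_closure.
    by rewrite /= in_itv /=; case/andP: tz => *; rewrite !ltW.
  have hz : 0 < h z.1 by case: Az => /h0.
  rewrite /Th mulrA [h _ * k]mulrC ler_pdivlMr// -ler_pdivrMr//.
  by apply: qmax; rewrite inE.
have cys : cylinder Omega (y, s) by split => //=; rewrite in_itv/= s0.
have := sub _ _ cys _ _ _
  (@parabolic_superjet_product _ _ _ _ _ _ _ _ _ _ _ dTh phiE phile).
have := Lsup y s Oy'; rewrite Ts sT => /(_ isT Ls).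
rewrite mulmx_scale_delta !dotv_scale_delta phiE.
rewrite !mxE !eqxx mulr1 -/h -/(Th s) => strict.
have Ths : 0 < Th s by rewrite /Th divr_gt0.
rewrite leNgt => /negP; apply.
have -> : k * (- (L s) ^- 2 * dL s) = - (Th s * dL s / L s).
  by rewrite /Th; field; rewrite gt_eqF.
(* Both terms of the subsolution inequality are homogeneous of degree 3 in
   Th s, so its sign is that of the strict supersolution condition. *)
rewrite [ltLHS](_ : _ = - (Th s ^+ 3 / L s *
    (8 * (y ord0 i - b) ^+ 2 * L s - 3 * h y ^+ 3 * dL s))).
  by rewrite oppr_lt0 mulr_gt0 ?subr_gt0// divr_gt0 ?exprn_gt0.
by field; rewrite gt_eqF.
Unshelve. all: by end_near. Qed.

(** * Uniform decay *)

Lemma bounded_set_closure_norm (R : realType) (n : nat) (A : set 'rV[R]_n) :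
  bounded_set A ->
  exists2 B : R, 1 <= B & forall x : 'rV[R]_n, closure A x -> `|x| <= B.
Proof.
move=> [M [_ HM]].
exists (Num.max 1 (M + 2)); first by rewrite le_max lexx.
move=> x Ax; have [w [Aw]] := Ax _ (nbhsx_ballx x 1 ltr01).
rewrite -ball_normE /= => xw.
have := HM (M + 1); rewrite ltrDl ltr01 => /(_ isT w Aw) /= wM.
have := ler_normD (x - w) w; rewrite subrK => xle.
rewrite le_max; apply/orP; right; lra.
Qed.

(** Compactness bounds phi by some M at the time where the comparison starts.
    A large M only delays the decay: with t the time elapsed, the contribution
    of M to phi L grows linearly in t, the peak value of L quadratically. *)
Lemma subsolution_uniform_decay (R : realType) (n : nat) (i : 'I_n)
    (Omega : set 'rV[R]_n) (phi : 'rV[R]_n * R -> R) :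
  open Omega -> bounded_set Omega ->
  {within closure Omega `*` `[0, +oo[, continuous phi} ->
  (forall z : 'rV[R]_n * R, (closure Omega `*` `[0, +oo[) z -> 0 < phi z) ->
  viscosity_subsolution (cylinder Omega) phi ->
  (forall e : R, 0 < e -> exists2 T, 0 <= T &
     forall x t, boundary Omega x -> T <= t -> phi (x, t) <= e) ->
  forall e : R, 0 < e -> exists2 T, 0 <= T &
    forall x t, closure Omega x -> T <= t -> phi (x, t) <= e.
Proof.
move=> oO bO phic phi0 sub lat e e0.
have [B B0 normB] := bounded_set_closure_norm _ _ _ bO.
have OB (x : 'rV[R]_n) : closure Omega x -> `|x ord0 i| <= B.
  move=> /normB; apply: le_trans.
  have /mapP[j Hj ->] : `|x ord0 i| \in [seq `|x z.1 z.2| | z : 'I_1 * 'I_n].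
    by apply/mapP; exists (ord0, i) => //=; rewrite mem_enum.
  rewrite [leRHS]/Num.norm /= mx_normrE; apply/bigmax_geP; right => /=.
  by exists j.
have cO : compact (closure Omega).
  apply: bounded_closed_compact; last exact: closed_closure.
  exists B; split; first exact: num_real.
  by move=> u Bu x Ox; rewrite /= (le_trans (normB _ Ox))// ltW.
(* The vertex 2 B of the parabola 18 B^2 - (x_i - 2 B)^2 lies at distance
   between B and 3 B from the coordinates of the closure of Omega, so there
   its values lie between 9 B^2 and 17 B^2. *)
pose H : R := 17 * B ^+ 2.
have H0 : 0 < H by rewrite /H mulr_gt0// exprn_gt0//; lra.
have eH0 : 0 < e / H by rewrite divr_gt0.
have [T T0 latT] := lat _ eH0.
have slab (t1 t2 : R) : T <= t1 ->
    closure Omega `*` `[t1, t2] `<=` closure Omega `*` `[0, +oo[.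
  move=> Tt z [Oz /=]; rewrite in_itv /= => /andP[tz _]; split => //=.
  by rewrite in_itv /= andbT (le_trans T0)// (le_trans Tt).
have [M M0 phiM] : exists2 M : R, 0 < M &
    forall x, closure Omega x -> phi (x, T) <= M.
  have cT := continuous_subspaceW (slab T T (lexx _)) phic.
  have /compact_bounded/ex_strict_bound_gt0[M M0 MP] :=
    continuous_compact cT (compact_setX cO (@segment_compact _ T T)).
  exists M => // x Ox; apply/ltW/(le_lt_trans (ler_norm _)).
  by apply: MP; exists (x, T) => //; split => //=; rewrite in_itv /= lexx.
(* Since h <= H, the choice tau0 = H^3 makes 3 h^3 / tau0 at most 3, below
   8, which is at most 8 (x_i - 2 B)^2. *)
pose tau0 : R := H ^+ 3.
have tau00 : 0 < tau0 by rewrite exprn_gt0.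
(* Once the elapsed time tau exceeds this wait, 2 M tau0 (tau + tau0), which
   exceeds the initial contribution M tau0 S, is at most
   (e / H) (tau + tau0)^2. *)
pose wait := 2 * M * tau0 / (e / H).
have wait_gt0 : 0 < wait.
  by apply: divr_gt0 => //; apply: mulr_gt0 => //; apply: mulr_gt0.
exists (T + wait); first by rewrite addr_ge0// ltW.
move=> x t Ox tT.
pose tau := t - T.
have wait_tau : wait <= tau by rewrite /tau; lra.
have tau_gt0 : 0 < tau by lra.
(* S is chosen so that L peaks at the given time t. *)
pose S := 2 * tau + tau0.
pose L u := (tau0 + (u - T)) * (S - (u - T)).
pose dL u := (S - (u - T)) - (tau0 + (u - T)).
pose K := e / H * (tau + tau0) ^+ 2.
have K0 : 0 < K by rewrite mulr_gt0// exprn_gt0// addr_gt0.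
have hbound (z : 'rV[R]_n) : closure Omega z ->
  let h := parabola i (18 * B ^+ 2) (2 * B) z in 1 <= h /\ h <= H.
  move=> /OB; rewrite ler_norml /parabola /H => /andP[z1 z2] /=.
  split; nra.
have phiL : phi (x, t) * L t <= K * parabola i (18 * B ^+ 2) (2 * B) x.
  apply: (@barrier_comparison _ _ Omega phi i _ _ T (T + S) K L dL) => //.
  - exact: continuous_subspaceW (slab _ _ (lexx _)) phic.
  - by move=> z /(slab _ _ (lexx _)); apply: phi0.
  - by move=> z /hbound[h1 _]; lra.
  - move=> u; apply/is_derive1_caratheodory.
    exists (fun z => (S + T - (tau0 - T) - u) - z); split.
    + by move=> z; rewrite /L; ring.
    + apply: (@continuousB _ _ _ (cst (S + T - (tau0 - T) - u)) id).
        exact: cst_continuous.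
      exact: cvg_id.
    + by rewrite /dL; ring.
  - move=> z u Oz /andP[Tu uT] Lu.
    have Oz' := subset_closure Oz.
    have [h1 hH] := hbound _ Oz'.
    set h := parabola _ _ _ z in h1 hH *.
    have v0 : 0 < u - T by lra.
    have w0 : 0 < S - (u - T) by lra.
    have d1 : 1 <= (z ord0 i - 2 * B) ^+ 2.
      by have := OB _ Oz'; rewrite ler_norml => /andP[z1 z2]; nra.
    have h3 : h ^+ 3 <= tau0 by rewrite /tau0 lerXn2r// nnegrE; lra.
    have h30 : 0 <= h ^+ 3 by rewrite exprn_ge0//; lra.
    rewrite /L /dL; move: (u - T) (S - (u - T)) v0 w0 d1 h3 h30.
    move: ((z ord0 i - 2 * B) ^+ 2) (h ^+ 3) => d g v w v0 w0 d1 g3 g0.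
    have s1 : g * (w - (tau0 + v)) <= tau0 * w by nra.
    have s2 : tau0 * w < (tau0 + v) * w by rewrite ltr_pM2r// ltrDl.
    have s3 : (tau0 + v) * w <= d * ((tau0 + v) * w).
      by rewrite ler_peMl// mulr_ge0// ltW// addr_gt0.
    nra.
  - move=> z Oz; have [h1 _] := hbound _ Oz.
    apply: (@le_trans _ _ K).
      rewrite /L subrr addr0 subr0 /K.
      apply: (@le_trans _ _ (M * (tau0 * S))).
        by rewrite ler_wpM2r ?phiM// mulr_ge0 ?ltW// /S; lra.
      apply: (@le_trans _ _ (2 * M * tau0 * (tau + tau0))).
        have : 0 < M * tau0 by rewrite mulr_gt0.
        by rewrite /S; nra.
      have -> : 2 * M * tau0 = e / H * wait.
        by rewrite /wait [RHS]mulrC divfK// gt_eqF.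
      rewrite -mulrA (ler_pM2l eH0) expr2 ler_pM2r; lra.
    by rewrite ler_peMr// ltW.
  - move=> z u Bz /andP[Tu uT].
    have [h1 _] := hbound z (proj1 Bz).
    apply: (@le_trans _ _ K); last first.
      by rewrite ler_peMr// ltW.
    apply: (@le_trans _ _ (e / H * L u)).
      by rewrite ler_wpM2r ?latT// mulr_ge0//; lra.
    rewrite /K (ler_pM2l eH0) /L /S -subr_ge0.
    (* L is a parabola with vertex at t, its deficit a square. *)
    by rewrite (_ : _ - _ = (tau - (u - T)) ^+ 2) ?sqr_ge0//; ring.
  - by rewrite /L (_ : S - _ = 0) ?mulr0//; ring.
  - by move: tau_gt0; rewrite /S /tau => ?; apply/andP; split; lra.
have Lt : L t = (tau + tau0) ^+ 2 by rewrite /L -/tau /S; ring.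
have [_ hH] := hbound x Ox.
have P0 : 0 < (tau + tau0) ^+ 2 by apply: exprn_gt0; apply: addr_gt0.
rewrite -(ler_pM2r P0) -Lt (le_trans phiL)// /K Lt mulrAC (ler_pM2r P0).
by rewrite mulrAC ler_pdivrMr// ler_pM2l.
Qed.

(** * The theorem *)

Theorem lemma4p6 (R : realType) (n : nat) (hn : (2 <= n)%N)
    (Omega : set 'rV[R]_n) (hOmega : bounded_domain Omega)
    (f : 'rV[R]_n -> R) (g phi : 'rV[R]_n * R -> R)
    (hf : {within closure Omega, continuous f})
    (hf0 : forall x, closure Omega x -> 0 < f x)
    (hg : {within boundary Omega `*` `[0, +oo[, continuous g})
    (hg0 : forall x t, boundary Omega x -> 0 <= t -> 0 < g (x, t))
    (hphi : {within cylinder Omega `|` parabolic_boundary Omega, continuous phi})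
    (hphi0 : forall z, (cylinder Omega `|` parabolic_boundary Omega) z -> 0 < phi z)
    (hsub : viscosity_subsolution (cylinder Omega) phi)
    (hinit : forall x, closure Omega x -> phi (x, 0) = f x)
    (hlat : forall x t, boundary Omega x -> 0 <= t -> phi (x, t) = g (x, t))
    (hlim : ereal_sup [set (g (x, t))%:E | x in boundary Omega]
              @[t --> +oo%R] --> 0%E) :
  ereal_sup [set (phi z)%:E | z in Omega `*` `[t, +oo[] @[t --> +oo%R] --> 0%E.
Proof.
have oO : open Omega by case: hOmega.
have bO : bounded_set Omega by case: hOmega.
have [x0 Ox0] : Omega !=set0 by case: hOmega.
have domE : closure Omega `*` `[0, +oo[ `<=`
    cylinder Omega `|` parabolic_boundary Omega.
  move=> [x t] [/= Ox]; rewrite in_itv /= andbT => t0.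
  have [Oi|nOi] := pselect (Omega x); last first.
    right; right; split; rewrite /= ?in_itv /= ?andbT//.
    by split => //; rewrite (proj1 (interior_id _) oO).
  move: t0; rewrite le_eqVlt => /predU1P[<-|t0]; first by right; left.
  by left; split; rewrite //= in_itv /= t0.
have lat (e : R) : 0 < e -> exists2 T : R, 0 <= T &
    forall x t, boundary Omega x -> T <= t -> phi (x, t) <= e.
  move=> e0.
  have /hlim [T [_ HT]] : nbhs (0%R)%:E [set u : \bar R | (u < e%:E)%E].
    by apply: open_ereal_lt'; rewrite lte_fin.
  (* T + 1, as nearness to +oo only gives the bound for times beyond T. *)
  exists (Num.max 0 (T + 1)); first by rewrite le_max lexx.
  move=> x t Bx; rewrite ge_max => /andP[t0 Tt].
  rewrite hlat// ltW// -lte_fin; apply: le_lt_trans (HT t _); last by lra.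
  by apply: ereal_sup_ubound; exists x.
have decay := @subsolution_uniform_decay R n (Ordinal (ltnW hn)) Omega phi oO bO
  (continuous_subspaceW domE hphi) (fun z Az => hphi0 z (domE z Az)) hsub lat.
(* The lower bound 0 comes from a point of the nonempty Omega. *)
have bnd (e : R) : 0 < e -> \forall t \near +oo%R,
    (0 <= ereal_sup [set (phi z)%:E | z in Omega `*` `[t, +oo[] <= e%:E)%E.
  move=> /decay[T T0 HT]; near=> t.
  have Tt : T <= t by near: t; apply: nbhs_pinfty_ge; exact: num_real.
  apply/andP; split.
    apply: (@le_trans _ _ (phi (x0, t))%:E).
      rewrite lee_fin ltW// hphi0//; apply: domE; split.
        exact: subset_closure.
      by rewrite /= in_itv /= andbT (le_trans T0).
    apply: ereal_sup_ubound; exists (x0, t) => //.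
    by split; rewrite //= in_itv /= lexx.
  apply: ge_ereal_sup => w [[x u] [/= Ox]]; rewrite in_itv /= andbT => tu <-.
  by rewrite lee_fin HT//; [exact: subset_closure|exact: le_trans tu].
apply/fine_cvgP; split.
  apply: filterS (bnd 1 ltr01) => t /andP[s0 s1].
  by rewrite ge0_fin_numE// (le_lt_trans s1)// ltry.
apply/cvgrPdist_le => e e0; apply: filterS (bnd e e0) => t /andP[s0 s1] /=.
rewrite sub0r normrN ger0_norm ?fine_ge0//.
by rewrite -lee_fin fineK// ge0_fin_numE// (le_lt_trans s1)// ltry.
Unshelve. all: by end_near. Qed.
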